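(* Let $n\ge 1$ be an integer, let $z_1,\dots,z_n\in\mathbb{C}$ (not necessarily distinct) satisfy $|z_1|=\dots=|z_n|=1$, and let $g_n(z)=\sum_{k=1}^n\frac{1}{z-z_k}$. Let $0<\delta<1/2$ and $$E=\big\{x\in[-1,1]:\ |\mathrm{Re}(x g_n(x))|\ge \delta n\big\},\qquad \Delta=\Big\{x\in[-1,1]:\ |x|>1-\frac{3}{(2+4\delta)n}\Big\}.$$ Then $$\mu(E)\ge K n^{-1},\qquad K=K(\delta):=\frac{3}{32}\,\frac{1-2\delta}{(1+2\delta)^2}>0.$$ Moreover, $\mu(E)$ can be replaced here by $\mu(E\cap\Delta)$, i.e. $\mu(E\cap\Delta)\ge K n^{-1}$.
   Context: $\mu$ denotes the linear (Lebesgue) measure on $\mathbb{R}$. The function $g_n$ may be undefined at $x=\pm1$ (its only possible real poles); these points do not affect the measure. *)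

(* Defs.v *)
From HB Require Import structures.
From mathcomp Require Import all_boot all_order all_algebra.
From mathcomp Require Import complex.
From mathcomp Require Import all_classical all_reals all_analysis.
Set Implicit Arguments.
Unset Strict Implicit.
Unset Printing Implicit Defensive.
Import Order.TTheory GRing.Theory Num.Theory.
Import numFieldNormedType.Exports.
Local Open Scope classical_set_scope.
Local Open Scope ring_scope.
Local Open Scope complex_scope.

Definition gsum (R : realType) (n : nat) (z : 'I_n -> R[i]) (w : R[i]) : R[i] :=
  \sum_(k < n) 1 / (w - z k).

(* MathComp sets 0^-1 = 0, so [gsum z] has a junk value at its poles; they are
   excluded explicitly. When all |z k| = 1, only x = 1 and x = -1 can be poles
   on the real line, so this removes a null set. *)
Definition Eset (R : realType) (n : nat) (z : 'I_n -> R[i]) (delta : R) : set R :=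
  [set x : R | [/\ -1 <= x <= 1,
                   forall k : 'I_n, x%:C != z k &
                   delta * n%:R <= `|complex.Re (x%:C * gsum z x%:C)| ]].

Definition Deltaset (R : realType) (n : nat) (delta : R) : set R :=
  [set x : R | -1 <= x <= 1 /\
               1 - 3 / ((2 + 4 * delta) * n%:R) < `|x| ].

Definition Kconst (R : realType) (delta : R) : R :=
  3 / 32 * ((1 - 2 * delta) / (1 + 2 * delta) ^+ 2).

(* Main.v *)
Require Import Defs.
From HB Require Import structures.
From mathcomp Require Import all_boot all_order all_algebra.
From mathcomp Require Import complex.
From mathcomp Require Import all_classical all_reals all_analysis.
From mathcomp Require Import ring lra.
Set Implicit Arguments.
Unset Strict Implicit.
Import Order.TTheory GRing.Theory Num.Theory.
Import numFieldNormedType.Exports.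
Local Open Scope classical_set_scope.
Local Open Scope ring_scope.
Local Open Scope complex_scope.

(** Write [A = 1 + 2 delta] and [B = 1 - 2 delta].  For [|z| = 1] and real [x],
    the real part of [x / (x - z)] is [(1 - p) / 2], where
    [p = (1 - x^2) / |x - z|^2] is the Poisson kernel of the unit disc.  Hence
    [Re (x g_n(x)) = (n - P(x)) / 2], where [P] is the sum of the [n] Poisson
    kernels, and [x] lies in [E] as soon as [P(x) <= B n] or [P(x) >= A n].

    Look at [P] just to the left of [x = 1] only, with [t = 1 - x] and
    [h = 1 / (A n)], so that [K / n = (3/32) (B n) h^2].  As [t] decreases to
    [0], each kernel behaves like [2 t / (t^2 + d^2)], [d = |1 - z|]: it is of
    size [1 / t] when [d] is at most [t] and close to linear in [t] when [d] is
    not small compared with [t].  This leads to a trichotomy.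
    - Some [z_k] is within [3 h / 4] of [1].  Its kernel alone is at least
      [1 / h = A n] for all [t] in [[3 h / 4, h]] ([poisson_near_pole]).
    - No [z_k] is that close, and [P <= B n] for all [t] in [(0, K / n)].
    - No [z_k] is that close, and [P > B n] for some [t0 < K / n].  Then every
      kernel grows at least by the factor [A / B] between [t0] and any [t] in
      [[3 h / 4, h]] ([poisson_growth]), so [P > A n] on that interval.
    In all cases [E] contains an interval of length [K / n] or [h / 4 >= K / n]
    inside [x >= 1 - h], which is part of [Delta] because
    [Delta] reaches down to [1 - 3 h / 2]. *)

(** The Poisson kernel [(1 - x^2) / |x - z|^2] of the unit disc in terms of
    [t = 1 - x] and the squared chord [e = |1 - z|^2]. *)
Definition poisson (R : realType) (t e : R) : R :=
  t * (2 - t) / (t ^+ 2 + (1 - t) * e).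

Section PoissonKernel.
Variable R : realType.
Implicit Types t e h c : R.

Lemma poisson_denom_gt0 t e : 0 < t -> t <= 1 -> 0 <= e ->
  0 < t ^+ 2 + (1 - t) * e.
Proof.
move=> t0 t1 e0; apply: ltr_pwDl; first exact: exprn_gt0.
by apply: mulr_ge0 => //; lra.
Qed.

Lemma poisson_ge0 t e : 0 < t -> t <= 1 -> 0 <= e -> 0 <= poisson t e.
Proof.
move=> t0 t1 e0; apply: divr_ge0; last exact/ltW/poisson_denom_gt0.
by apply: mulr_ge0; lra.
Qed.

(** With [|1 - z| <= t] the denominator is at most [t^2 + (1 - t) t^2], which
    is [t^2 (2 - t)], so the kernel is at least [1 / t]. *)
Lemma poisson_near_pole t e h : 0 < t -> t <= h -> t <= 1 -> 0 <= e ->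
  e <= t ^+ 2 -> h^-1 <= poisson t e.
Proof.
move=> t0 th t1 e0 et; apply: (@le_trans _ _ t^-1).
  by rewrite lef_pV2 ?posrE //; apply: lt_le_trans th.
rewrite ler_pdivlMr; last exact: poisson_denom_gt0.
rewrite ler_pdivrMl //; have : 0 <= 1 - t by lra.
nra.
Qed.

(** For [e] not small compared with [t^2] the denominator of the kernel is at
    least [3 e / 4] at [t0] and at most [3 e] at [t], so the kernel is linear
    up to constants; the factor [8] pays for these constants
    and for [2 - t] varying between [1] and [2]. *)
Lemma poisson_growth t0 t e c : 0 < t0 -> c <= 1 -> 8 * t0 <= c * t ->
  0 < t -> t <= 1 -> t ^+ 2 <= 2 * e ->
  poisson t0 e <= c * poisson t e.
Proof.
move=> t00 c1 t0t tp t1 te.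
have e0 : 0 <= e by have := sqr_ge0 t; lra.
have ct1 : c * t <= 1 by nra.
have ct0 : 0 <= c * t by lra.
rewrite /poisson mulrA ler_pdivrMr; last by apply: poisson_denom_gt0 => //; lra.
rewrite mulrAC ler_pdivlMr; last exact: poisson_denom_gt0.
have den_t0 : 3 / 4 * e <= t0 ^+ 2 + (1 - t0) * e.
  have := sqr_ge0 t0; nra.
have den_t : t ^+ 2 + (1 - t) * e <= 3 * e by nra.
have num_t : c * t <= c * (t * (2 - t)) by rewrite mulrA ler_peMr //; lra.
apply: (@le_trans _ _ (t0 * 2 * (3 * e))).
  apply: ler_pM => //; first by apply: mulr_ge0; lra.
  - exact/ltW/poisson_denom_gt0.
  - by rewrite ler_pM2l //; lra.
apply: (@le_trans _ _ (c * t * (3 / 4 * e))); first by nra.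
by apply: ler_pM => //; lra.
Qed.

End PoissonKernel.

(** A sum of Poisson kernels cannot stay between [L] and [1 / h] near the
    boundary.  The constant [3/32] makes [8 t0 <= (L h) t] for
    [t0 < (3/32) L h^2] and [t >= 3 h / 4], which is what growth by the factor
    [1 / (L h)] requires. *)
Lemma poisson_sum_dichotomy (R : realType) (n : nat) (e : 'I_n -> R) (L h : R) :
  (forall k, 0 <= e k) -> 0 < h -> h <= 1 -> 0 < L -> L * h <= 1 ->
  (forall t, 0 < t -> t < 3 / 32 * (L * h ^+ 2) ->
     \sum_(k < n) poisson t (e k) <= L) \/
  (forall t, 3 / 4 * h <= t -> t <= h ->
     h^-1 <= \sum_(k < n) poisson t (e k)).
Proof.
move=> e0 h0 h1 L0 Lh1.
have [[k0 ek0]|far] := pselect (exists k, e k <= (3 / 4 * h) ^+ 2).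
  right=> t tl th; have t0 : 0 < t by lra.
  rewrite (bigD1 k0) //=.
  apply: (@le_trans _ _ (poisson t (e k0))).
    apply: poisson_near_pole => //; first by lra.
    apply: le_trans ek0 _; rewrite lerXn2r // nnegrE; lra.
  by rewrite lerDl; apply: sumr_ge0 => k _; apply: poisson_ge0 => //; lra.
have far_lt k : (3 / 4 * h) ^+ 2 < e k.
  by rewrite ltNge; apply/negP => ek; apply: far; exists k.
have [[t0 [t00 t0K Lt0]]|low] := pselect (exists t0, [/\ 0 < t0,
    t0 < 3 / 32 * (L * h ^+ 2) & L < \sum_(k < n) poisson t0 (e k)]); last first.
  left=> t t0 tK; rewrite leNgt; apply/negP => Lt.
  by apply: low; exists t.
right=> t tl th.
have Lh0 : 0 < L * h by apply: mulr_gt0.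
have t08 : 8 * t0 <= L * h * t.
  have : L * h * (3 / 4 * h) <= L * h * t by rewrite ler_pM2l.
  have : L * h * (3 / 4 * h) = 8 * (3 / 32 * (L * h ^+ 2)) by field.
  lra.
have grow : \sum_(k < n) poisson t0 (e k) <=
    L * h * \sum_(k < n) poisson t (e k).
  rewrite mulr_sumr; apply: ler_sum => k _.
  apply: poisson_growth => //; [lra|lra|].
  apply: (@le_trans _ _ (h ^+ 2)); first by rewrite lerXn2r // nnegrE; lra.
  by have := far_lt k; have := sqr_ge0 h; rewrite exprMn; lra.
rewrite -(ler_pM2l Lh0) -mulrA divff ?gt_eqF // mulr1.
exact/ltW/(lt_le_trans Lt0).
Qed.

Section UnitCircle.
Variable R : realType.
Implicit Type w : R[i].

Lemma unit_circleE w : `|w| = 1 -> complex.Re w ^+ 2 + complex.Im w ^+ 2 = 1.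
Proof.
move=> w1; have := add_Re2_Im2 w; rewrite w1 expr1n.
by move/(congr1 (@complex.Re R)).
Qed.

Lemma chord_ge0 w : `|w| = 1 -> 0 <= 2 * (1 - complex.Re w).
Proof. by move=> /unit_circleE; have := sqr_ge0 (complex.Im w); nra. Qed.

Lemma real_neq_unit (x : R) w : `|w| = 1 -> 0 <= x -> x < 1 -> x%:C != w.
Proof.
move=> w1 x0 x1; apply/eqP => xw; have := unit_circleE w1.
by rewrite -xw /= expr0n addr0; nra.
Qed.

(** [2 Re (x / (x - z)) - 1 = Re ((x + z) / (x - z))], and the latter is minus
    the Poisson kernel. *)
Lemma Re_unit_pole (t : R) w : `|w| = 1 -> 0 < t -> t <= 1 ->
  complex.Re ((1 - t)%:C * (1 / ((1 - t)%:C - w))) =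
  (1 - poisson t (2 * (1 - complex.Re w))) / 2.
Proof.
move=> w1 t0 t1; have := poisson_denom_gt0 t0 t1 (chord_ge0 w1).
have := unit_circleE w1; rewrite /poisson; case: w {w1} => a b /= ab dpos.
rewrite mul1r /= !mul0r !subr0 sub0r.
have -> : (1 - t - a) ^+ 2 + (- b) ^+ 2 =
    t ^+ 2 + (1 - t) * (2 * (1 - a)).
  rewrite sqrrN; have -> : b ^+ 2 = 1 - a ^+ 2 by lra.
  ring.
field; rewrite gt_eqF //.
Qed.

Lemma Re_gsum (n : nat) (z : 'I_n -> R[i]) (t : R) :
  (forall k, `|z k| = 1) -> 0 < t -> t <= 1 ->
  complex.Re ((1 - t)%:C * gsum z (1 - t)%:C) =
  (n%:R - \sum_(k < n) poisson t (2 * (1 - complex.Re (z k)))) / 2.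
Proof.
move=> z1 t0 t1; rewrite /gsum mulr_sumr raddf_sum /=.
rewrite (eq_bigr _ (fun k _ => Re_unit_pole (z1 k) t0 t1)) -mulr_suml sumrB.
by rewrite sumr_const card_ord.
Qed.

End UnitCircle.

Lemma mem_Eset_Deltaset (R : realType) (n : nat) (z : 'I_n -> R[i])
    (delta t : R) :
  (1 <= n)%N -> (forall k, `|z k| = 1) -> 0 < delta ->
  0 < t -> t <= ((1 + 2 * delta) * n%:R)^-1 ->
  let P := \sum_(k < n) poisson t (2 * (1 - complex.Re (z k))) in
  P <= (1 - 2 * delta) * n%:R \/ (1 + 2 * delta) * n%:R <= P ->
  (Eset z delta `&` Deltaset n delta) (1 - t).
Proof.
move=> n1 z1 d0 t0 th P HP.
have n1R : 1 <= n%:R :> R by rewrite ler1n.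
have An1 : 1 < (1 + 2 * delta) * n%:R by nra.
have t1 : t < 1.
  by apply: le_lt_trans th _; rewrite invf_lt1 //; lra.
split.
  split=> [|k|]; [lra|by apply: (real_neq_unit (z1 k)); lra|].
  rewrite Re_gsum ?(ltW t1) // -/P ler_normr.
  by apply/orP; case: HP => HP; [left|right]; lra.
split; first by lra.
rewrite ger0_norm; last by lra.
have -> : 3 / ((2 + 4 * delta) * n%:R) =
    3 / 2 * ((1 + 2 * delta) * n%:R)^-1.
  by field; rewrite !gt_eqF //; lra.
lra.
Qed.

(** Arbitrary [S] are covered because [lebesgue_measure] is an outer measure,
    hence monotone on all sets and not only on the measurable ones. *)
Lemma lebesgue_measure_ge_itv (R : realType) (S : set R) (a b c : R) :
  c <= b - a -> a < b -> `]a, b[ `<=` S -> (c%:E <= lebesgue_measure S)%E.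
Proof.
move=> cba ab subS; apply: (@le_trans _ _ (lebesgue_measure `]a, b[)).
  by rewrite lebesgue_measure_itv /= lte_fin ab -EFinB lee_fin.
exact: le_outer_measure.
Qed.

Theorem theorem2 (R : realType) (n : nat) (hn : (1 <= n)%N)
    (z : 'I_n -> R[i]) (hz : forall k : 'I_n, `|z k| = 1)
    (delta : R) (hdelta0 : 0 < delta) (hdelta1 : delta < 1 / 2) :
  [/\ 0 < Kconst delta,
      ((Kconst delta * n%:R^-1)%:E <= lebesgue_measure (Eset z delta))%E &
      ((Kconst delta * n%:R^-1)%:E <=
         lebesgue_measure (Eset z delta `&` Deltaset n delta))%E ].
Proof.
have n1R : 1 <= n%:R :> R by rewrite ler1n.
have K0 : 0 < Kconst delta.
  by rewrite /Kconst !(mulr_gt0, invr_gt0, exprn_gt0) //; lra.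
suff ED : ((Kconst delta * n%:R^-1)%:E <=
    lebesgue_measure (Eset z delta `&` Deltaset n delta))%E.
  split=> //; apply: le_trans ED _.
  by apply: le_outer_measure => x [].
set A := 1 + 2 * delta; set B := 1 - 2 * delta.
set h := (A * n%:R)^-1; set L := B * n%:R.
have An1 : 1 <= A * n%:R by rewrite /A; nra.
have h0 : 0 < h by rewrite invr_gt0; lra.
have h1 : h <= 1 by rewrite invf_le1; lra.
have L0 : 0 < L by rewrite mulr_gt0 // /B; lra.
have Lh1 : L * h <= 1.
  by rewrite ler_pdivrMr ?mul1r /L /A /B; nra.
have KE : Kconst delta * n%:R^-1 = 3 / 32 * (L * h ^+ 2).
  rewrite /Kconst /L /h -/A -/B; field.
  by rewrite !gt_eqF // /A; lra.
have Kh : 3 / 32 * (L * h ^+ 2) <= h / 4.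
  have : (L * h) * h <= h by rewrite ler_piMl // ltW.
  by rewrite expr2 mulrA; lra.
have Kpos : 0 < 3 / 32 * (L * h ^+ 2).
  by apply: mulr_gt0; [lra|rewrite mulr_gt0 ?exprn_gt0].
rewrite KE.
have [low|high] := poisson_sum_dichotomy (fun k => chord_ge0 (hz k))
    h0 h1 L0 Lh1.
  apply: (@lebesgue_measure_ge_itv _ _ (1 - 3 / 32 * (L * h ^+ 2)) 1).
  - lra.
  - lra.
  move=> x /=; rewrite in_itv /= => /andP[xl xr].
  rewrite -[x](subKr 1); apply: mem_Eset_Deltaset => //; [lra| |].
    by rewrite -/A -/h; lra.
  by left; apply: low; lra.
apply: (@lebesgue_measure_ge_itv _ _ (1 - h) (1 - 3 / 4 * h)); [lra|lra|].
move=> x /=; rewrite in_itv /= => /andP[xl xr].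
rewrite -[x](subKr 1); apply: mem_Eset_Deltaset => //; [lra| |].
  by rewrite -/A -/h; lra.
by right; rewrite -/A -[leLHS]invrK; apply: high; lra.
Qed.
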